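(* For any integer $d \geq 1$, any weights $\gamma=(\gamma_{\mathfrak{u}})_{\emptyset \neq \mathfrak{u} \subset \{1, \dots, d\}}$ (non-negative real numbers), and any integer $N \geq 1$ there exist points $x_1,\dots, x_N \in [0,1]^d$ such that $$ D_{N,\gamma}^*(x_1, \dots, x_N) \leq \frac{5.7}{\sqrt{N}}~ \max_{\emptyset \neq \mathfrak{u} \subset \{1, \dots,d\}} \gamma_{\mathfrak{u}} \sqrt{4.9 + 2 \log \left(\frac{ed}{|\mathfrak{u}|}\right)} \sqrt{|\mathfrak{u}|}. $$
   Context: Here $e$ is Euler's number, $\log$ is the natural logarithm, and $|\mathfrak{u}|$ denotes the cardinality of $\mathfrak{u}$. Points in a point set $x_1,\dots,x_N$ are counted with multiplicity. For $x_1,\dots,x_N\in[0,1]^d$ and $z=(z_1,\dots,z_d)\in[0,1]^d$, the discrepancy function is $$\Delta(z)=\frac1N\sum_{n=1}^N \mathbf{1}_{[0,z)}(x_n)-\lambda([0,z)),$$ where $[0,z)=\prod_{i=1}^d[0,z_i)$ and $\lambda$ is $d$-dimensional Lebesgue measure. For a non-empty subset $\mathfrak{u}\subset\{1,\dots,d\}$, $(z(\mathfrak{u});1)$ denotes the point of $[0,1]^d$ obtained from $z$ by replacing every coordinate whose index is not in $\mathfrak{u}$ by $1$. Given weights, i.e. non-negative reals $\gamma_{\mathfrak{u}}$ indexed by the non-empty subsets of $\{1,\dots,d\}$, the weighted star-discrepancy is $$D_{N,\gamma}^*(x_1,\dots,x_N)=\sup_{z\in[0,1]^d}\ \max_{\emptyset\ne\mathfrak{u}\subset\{1,\dots,d\}}\gamma_{\mathfrak{u}}\,|\Delta(z(\mathfrak{u});1)|.$$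 *)

(* Defs.v *)
From HB Require Import structures.
From mathcomp Require Import all_boot all_order all_algebra.
From mathcomp Require Import all_classical all_reals all_analysis.

Set Implicit Arguments.
Unset Strict Implicit.
Unset Printing Implicit Defensive.

Import Order.TTheory GRing.Theory Num.Theory.

Local Open Scope classical_set_scope.
Local Open Scope ring_scope.

(* The product of m and mu, transported to (n+1)-tuples along cons. *)
Section cons_measure.
Local Open Scope ereal_scope.
Context {disp : measure_display} {T : measurableType disp} {R : realType}.
Variable m : {sigma_finite_measure set T -> \bar R}.
Context {n : nat}.
Variable mu : {sigma_finite_measure set (n.-tuple T) -> \bar R}.

Let cons_pair (p : T * n.-tuple T) : n.+1.-tuple T := [tuple of p.1 :: p.2].

Let mcons_pair : measurable_fun [set: T * n.-tuple T] cons_pair.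
Proof. exact: measurable_cons. Qed.

Definition cons_measure : set (n.+1.-tuple T) -> \bar R :=
  pushforward (m \x mu) cons_pair.

Let cons_measure0 : cons_measure set0 = 0.
Proof. by rewrite /cons_measure /pushforward preimage_set0 measure0. Qed.

Let cons_measure_ge0 A : 0 <= cons_measure A.
Proof. exact: measure_ge0. Qed.

Let cons_measure_sigma_additive : semi_sigma_additive cons_measure.
Proof.
pose f := mfun_Sub (mem_set mcons_pair).
exact: (@measure_semi_sigma_additive _ _ _ (pushforward (m \x mu) f)).
Qed.

HB.instance Definition _ := isMeasure.Build _ _ _ cons_measure
  cons_measure0 cons_measure_ge0 cons_measure_sigma_additive.

Let cons_measure_sigma_finite : sigma_finite setT cons_measure.
Proof.
have /sigma_finiteP[F [TF ndF Foo]] := sigma_finiteT m.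
have /sigma_finiteP[G [TG ndG Goo]] := sigma_finiteT mu.
pose g (t : n.+1.-tuple T) : T * n.-tuple T := (thead t, [tuple of behead t]).
have gK : cancel cons_pair g by move=> [a t]; congr pair; apply: val_inj.
have mg : measurable_fun setT g.
  apply/measurable_fun_pair; first exact: measurable_tnth.
  exact: measurable_behead.
exists (fun k => g @^-1` (F k `*` G k)) => [|k].
  apply/esym; rewrite -preimage_bigcup -subTset => t _.
  have [i _ Fi] : (\bigcup_i F i) (thead t) by rewrite -TF.
  have [j _ Gj] : (\bigcup_i G i) [tuple of behead t] by rewrite -TG.
  exists (maxn i j) => //; split.
  - by move: Fi; exact/subsetPset/ndF/leq_maxl.
  - by move: Gj; exact/subsetPset/ndG/leq_maxr.
have [mF Fk] := Foo k; have [mG Gk] := Goo k; split.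
  by rewrite -[X in measurable X]setTI; apply: mg => //; exact: measurableX.
rewrite /cons_measure /pushforward -comp_preimage.
rewrite (_ : g \o cons_pair = idfun); last by apply/funext => p; exact: gK.
by rewrite preimage_id product_measure1E// lte_mul_pinfty// ge0_fin_numE.
Qed.

HB.instance Definition _ := Measure_isSigmaFinite.Build _ _ _ cons_measure
  cons_measure_sigma_finite.

End cons_measure.

(* Lebesgue measure on R^d, as the d-fold product of Lebesgue measure on R;
   lebesgue_tuple_box below computes it on boxes. *)
Fixpoint lebesgue_tuple (R : realType) (d : nat) :
    {sigma_finite_measure set (d.-tuple (measurableTypeR R)) -> \bar R} :=
  match d with
  | 0 => dirac [tuple]
  | d'.+1 => cons_measure (@lebesgue_measure R) (lebesgue_tuple R d')
  end.

Section discrepancy.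
Context {R : realType} {d : nat}.
Implicit Types (z : d.-tuple R) (u : {set 'I_d}).

Definition unit_cube : set (d.-tuple R) :=
  [set z | forall i, 0 <= tnth z i <= 1].

Definition anchored_box z : set (d.-tuple R) :=
  [set y | forall i, 0 <= tnth y i < tnth z i].

Definition discrepancy (N : nat) (x : 'I_N -> d.-tuple R) z : R :=
  N%:R^-1 * (\sum_(n < N) \1_(anchored_box z) (x n))
    - fine (lebesgue_tuple R d (anchored_box z)).

(* (z(u); 1) *)
Definition pad_one u z : d.-tuple R :=
  [tuple if i \in u then tnth z i else 1 | i < d].

(* The maximum of F over the non-empty subsets of {1, ..., d}, for F
   non-negative there and d >= 1. *)
Definition max_nonempty (F : {set 'I_d} -> R) : R :=
  \big[Num.max/0]_(u : {set 'I_d} | u != finset.set0) F u.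

(* Extended-real supremum, so that the value is meaningful without a
   separate boundedness argument. *)
Definition weighted_star_discrepancy (gamma : {set 'I_d} -> R)
    (N : nat) (x : 'I_N -> d.-tuple R) : \bar R :=
  ereal_sup [set (max_nonempty (fun u =>
    gamma u * `|discrepancy x (pad_one u z)|))%:E | z in unit_cube].

End discrepancy.

Lemma measurable_anchored_box (R : realType) (d : nat) (z : d.-tuple R) :
  measurable (anchored_box z : set (d.-tuple (measurableTypeR R))).
Proof.
rewrite (_ : anchored_box z = \bigcap_(i in [set: 'I_d])
    ((fun t : d.-tuple (measurableTypeR R) => tnth t i) @^-1`
      `[0, tnth z i[%classic)).
  apply: fin_bigcap_measurable => [|i _]; first exact: finite_finset.
  rewrite -[X in measurable X]setTI.
  apply: (@measurable_tnth _ (measurableTypeR R) d i measurableT).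
  exact: measurable_itv.
apply/seteqP; split => t /= tz i.
  by move=> _; rewrite /= in_itv/=; exact: tz.
by have := tz i Logic.I; rewrite /= in_itv.
Qed.

Lemma lebesgue_tuple_box (R : realType) (d : nat) (z : d.-tuple R) :
  (forall i, 0 <= tnth z i) ->
  lebesgue_tuple R d (anchored_box z) = (\prod_(i < d) tnth z i)%:E.
Proof.
elim: d z => [|d IH] z z0.
  by rewrite big_ord0 /= diracE mem_set//; case.
rewrite big_ord_recl EFinM.
pose z' : d.-tuple R := [tuple of behead z].
have z'E i : tnth z (lift ord0 i) = tnth z' i.
  by rewrite [in LHS](tuple_eta z) tnthS.
under eq_bigr do rewrite z'E.
rewrite -IH; last by move=> i; rewrite -z'E.
rewrite /= /cons_measure /pushforward.
rewrite (_ : _ @^-1` _ = `[0, tnth z ord0[%classic `*` anchored_box z').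
  rewrite product_measure1E//; last exact: measurable_anchored_box.
  congr (_ * _)%E; apply: etrans (lebesgue_measure_itv `[0, tnth z ord0[) _.
  rewrite /= lte_fin; case: ltP => [_|z00]; first by rewrite oppr0 adde0.
  by have /eqP-> : tnth z ord0 == 0 by rewrite eq_le z00 z0.
apply/seteqP; split => -[a t] /= => [h|[+ h] i].
- split => [|i]; first by rewrite in_itv/=; exact: (h ord0).
  by have := h (lift ord0 i); rewrite z'E tnthS.
- rewrite in_itv/= => a0; case: (unliftP ord0 i) => [j ->|->]//.
  by rewrite z'E tnthS; exact: h.
Qed.

(* Main.v *)
(* The points are drawn independently, and the discrepancy is controlled by
   Bernstein's inequality along a chain of boxes on ever finer grids.

   For a subset u of size s, take the boxes with corners exp(- m_i h), i in u,
   with h = 4^-j / (16 s). Rounding every coordinate down to the grid of the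
   previous level changes the volume by O(4^-j), so the indicator of a box at
   level J is a sum of indicators with variances O(4^-j), j <= J. Boxes whose
   volume is below the resolution are discarded, which leaves (O(8^j))^s of them
   at level j. With D = 5.7 sqrt((4.9 + 2 l) s / N) and l = log(e d / s), a
   deviation of N D (3/5)^j / 4 at level j has probability at most
   2 exp(- s (l + 9 + 3 j)); as there are at most exp(s l) subsets of size s,
   the total failure probability is less than 1. These deviations add up to
   5/8 N D, and the final level is chosen so that the error of bracketing an
   arbitrary box is at most 3/8 N D. If D >= 1, there is nothing to prove.

   Only finitely many boxes matter, so the uniform law on [0, 1] is replaced by
   a finite one which is exact on all grid coordinates. *)
Require Import Defs.
From mathcomp Require Import all_boot all_order all_algebra.
From mathcomp Require Import all_classical all_reals all_analysis.
From mathcomp Require Import ring lra zify.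

Set Implicit Arguments.
Unset Strict Implicit.

Import Order.TTheory GRing.Theory Num.Theory.

Local Open Scope classical_set_scope.
Local Open Scope ring_scope.

(** * Finite tools: exponential moments, a discrete uniform law, counting of exponent vectors *)

(** Since [exp(-x) >= (1 - x/3)^3], it suffices that [(1 - x/3)^3 (1 + x + x^2) >= 1], whose
    expansion has no linear term. *)
Lemma expR_le_quadratic (R : realType) (x : R) :
  `|x| <= 1 / 2 -> expR x <= 1 + x + x ^+ 2.
Proof.
rewrite ler_norml => /andP[x1 x2].
have h : 1 - x / 3 <= expR (- (x / 3)) by have := expR_ge1Dx (- (x / 3)); lra.
have h3 : (1 - x / 3) ^+ 3 <= expR (- x).
  rewrite (_ : - x = 3%:R * - (x / 3)); last by field.
  by rewrite expRM_natl; apply: lerXn2r => //; rewrite nnegrE ?expR_ge0//; lra.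
rewrite -[x in expR x]opprK expRN invf_ple ?posrE ?expR_gt0//; last by nra.
apply: le_trans h3.
have -> : (1 + x + x ^+ 2)^-1 = 1 / (1 + x + x ^+ 2) by rewrite mul1r.
rewrite ler_pdivrMr; last by nra.
have -> : (1 - x / 3) ^+ 3 * (1 + x + x ^+ 2) =
  1 + x ^+ 2 * (1 / 3 - 19 / 27 * x + 8 / 27 * x ^+ 2 - x ^+ 3 / 27) by field.
rewrite lerDl mulr_ge0 ?sqr_ge0//.
have h2 : 0 <= x ^+ 2 * (1 / 2 - x) by rewrite mulr_ge0 ?sqr_ge0//; lra.
nra.
Qed.

(** The centred indicator is [1 - p] with probability [p] and [-p] otherwise. In the quadratic bound
    for the exponential the linear terms cancel, leaving [1 + lambda^2 p (1 - p)]. *)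
Lemma mgf_bernoulli (R : realType) (T : finType) (P : T -> R) (f : pred T)
    (lambda v : R) (p := \sum_(t | f t) P t) :
  (forall t, 0 <= P t) -> \sum_t P t = 1 -> `|lambda| <= 1 / 2 ->
  p * (1 - p) <= v ->
  \sum_t P t * expR (lambda * ((f t)%:R - p)) <= expR (lambda ^+ 2 * v).
Proof.
move=> P0 P1 lam pv.
have sC : \sum_(t | ~~ f t) P t = 1 - p.
  by have := P1; rewrite (bigID f)/= -/p => <-; rewrite [p + _]addrC addrK.
have p0 : 0 <= p by exact: sumr_ge0.
have p1 : 0 <= 1 - p by rewrite -sC; exact: sumr_ge0.
rewrite (bigID f)/=.
under eq_bigr => t ft do rewrite ft/=.
under [X in _ + X]eq_bigr => t /negbTE ft do rewrite ft/=.
rewrite -!mulr_suml sC -/p.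
have lam1 (q : R) : `|q| <= 1 -> `|lambda * q| <= 1 / 2.
  by move=> q1; rewrite normrM -[leRHS]mulr1 ler_pM.
have h1 := expR_le_quadratic (lam1 (1 - p) _).
have h2 := expR_le_quadratic (lam1 (0 - p) _).
apply: (@le_trans _ _ (1 + lambda ^+ 2 * v)); last exact: expR_ge1Dx.
apply: (@le_trans _ _ (1 + lambda ^+ 2 * (p * (1 - p)))); last first.
  by rewrite lerD2l ler_wpM2l ?sqr_ge0.
apply: le_trans (lerD (ler_wpM2l p0 (h1 _)) (ler_wpM2l p1 (h2 _))) _.
- by rewrite ger0_norm//; lra.
- by rewrite sub0r normrN ger0_norm//; lra.
- by rewrite le_eqVlt; apply/orP; left; apply/eqP; ring.
Qed.

Lemma expectation_prod (R : realType) (T : finType) (P phi : T -> R) (N : nat) :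
  \sum_(x : {ffun 'I_N -> T}) (\prod_n P (x n)) * \prod_n phi (x n) =
  (\sum_t P t * phi t) ^+ N.
Proof.
transitivity (\prod_(n < N) \sum_t P t * phi t).
  by rewrite bigA_distr_bigA; apply: eq_bigr => x _; rewrite big_split.
by rewrite prodr_const card_ord.
Qed.

(* If every x had a large deviation, then 1 <= \sum_i E i x for all x, although
   the average of the right-hand side over x is less than 1. *)
Lemma exists_small_deviations (R : realType) (T : finType) (P : T -> R)
    (N : nat) (I : finType) (Q : pred I) (f : I -> pred T)
    (a lambda v : I -> R) (p := fun i => \sum_(t | f i t) P t) :
  (forall t, 0 <= P t) -> \sum_t P t = 1 ->
  (forall i, Q i -> 0 <= lambda i <= 1 / 2) ->
  (forall i, Q i -> p i * (1 - p i) <= v i) ->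
  \sum_(i | Q i) 2 * expR (N%:R * (lambda i ^+ 2 * v i) - lambda i * a i) < 1 ->
  exists x : 'I_N -> T, forall i, Q i ->
    `|\sum_n (f i (x n))%:R - N%:R * p i| <= a i.
Proof.
move=> P0 P1 lam pv Q1; apply: contrapT => noexists.
pose S i (x : 'I_N -> T) := \sum_n ((f i (x n))%:R - p i).
have SE i x : S i x = \sum_n (f i (x n))%:R - N%:R * p i.
  by rewrite /S sumrB sumr_const card_ord mulr_natl.
(* One exponential for each sign of the deviation; if it exceeds [a i] in absolute value, one of the
   two is at least 1. *)
pose E i (x : 'I_N -> T) := expR (lambda i * S i x - lambda i * a i) +
  expR (- lambda i * S i x - lambda i * a i).
have W1 : \sum_(x : {ffun 'I_N -> T}) (\prod_n P (x n)) = 1.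
  by rewrite -(bigA_distr_bigA (fun _ : 'I_N => P)) P1 prodr_const expr1n.
have E1 (x : 'I_N -> T) : 1 <= \sum_(i | Q i) E i x.
  have [i Qi ai] : exists2 i, Q i & a i < `|S i x|.
    apply: contrapT => noi; apply: noexists; exists x => i Qi.
    by rewrite leNgt -SE; apply/negP => ai; apply: noi; exists i.
  rewrite (bigD1 i)//= ler_wpDr ?sumr_ge0//.
    by move=> j _; rewrite addr_ge0 ?expR_ge0.
  have /andP[l0 _] := lam i Qi.
  have ge1 (y : R) : 0 <= y -> 1 <= expR y.
    by rewrite le_eqVlt => /predU1P[<-|/pexpR_gt1/ltW//]; rewrite expR0.
  have [S0|S0] := leP 0 (S i x).
    rewrite ler_wpDr ?expR_ge0// ge1// -mulrBr mulr_ge0//.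
    by move: ai; rewrite ger0_norm// => /ltW; rewrite subr_ge0.
  rewrite ler_wpDl ?expR_ge0// ge1// mulNr -mulrN -mulrBr mulr_ge0//.
  by move: ai; rewrite ltr0_norm// => /ltW; rewrite subr_ge0.
have EW i : Q i -> \sum_(x : {ffun 'I_N -> T}) (\prod_n P (x n)) * E i x <=
    2 * expR (N%:R * (lambda i ^+ 2 * v i) - lambda i * a i).
  move=> Qi.
  have half (mu : R) : `|mu| <= 1 / 2 ->
      \sum_(x : {ffun 'I_N -> T}) (\prod_n P (x n)) *
         expR (mu * S i x - lambda i * a i)
      <= expR (N%:R * (mu ^+ 2 * v i) - lambda i * a i).
    move=> mu1; rewrite expRD expRM_natl.
    under eq_bigr => x _ do
      rewrite expRD /S mulr_sumr expR_sum mulrA.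
    rewrite -mulr_suml (expectation_prod P (fun t => expR (mu * ((f i t)%:R - p i)))).
    rewrite ler_wpM2r ?expR_ge0//; apply: lerXn2r; rewrite ?nnegrE ?expR_ge0//.
      by apply: sumr_ge0 => t _; rewrite mulr_ge0 ?expR_ge0.
    by apply: mgf_bernoulli => //; exact: pv.
  have /andP[l0 l1] := lam i Qi.
  under eq_bigr do rewrite mulrDr.
  rewrite big_split/= mulr2n mulrDl !mul1r lerD//.
    by apply: half; rewrite ger0_norm.
  by rewrite -[lambda i ^+ 2]sqrrN half// normrN ger0_norm.
suff : (1 : R) < 1 by rewrite ltxx.
apply: le_lt_trans Q1; rewrite -{1}W1.
apply: le_trans (ler_sum _ EW); rewrite exchange_big/=.
apply: ler_sum => x _; rewrite -mulr_sumr ler_peMr ?E1//.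
by apply: prodr_ge0.
Qed.

(* A finite substitute for the uniform law on [0, 1], exact at the breakpoints
   b i: the atoms are the sorted breakpoints, weighted by the gap to the next. *)
Lemma exists_uniform_atoms (R : realType) (I : finType) (b : I -> R) :
  (forall i, 0 <= b i <= 1) ->
  exists (n : nat) (pt w : 'I_n -> R),
    [/\ forall j, 0 <= w j, forall j, 0 <= pt j <= 1, \sum_j w j = 1 &
        forall i, \sum_(j | pt j < b i) w j = b i].
Proof.
move=> b01; pose s := sort <=%O (codom b).
have bs i : b i \in s by rewrite mem_sort codom_f.
have s01 y : y \in s -> 0 <= y <= 1 by rewrite mem_sort => /codomP[i ->].
(* The prepended 0 is the first atom; the default value 1 closes the last gap at the right
   endpoint. *)
pose sg k := nth 1 (0 :: s) k.
have sgn : sg (size s).+1 = 1 by rewrite /sg nth_default.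
have sg01 k : 0 <= sg k <= 1.
  case: k => [|k]; rewrite /sg /= ?lexx ?ler01//.
  have [ks|ks] := ltnP k (size s); first exact/s01/mem_nth.
  by rewrite nth_default// ler01 lexx.
have sgS k : sg k <= sg k.+1.
  have [ks|ks] := ltnP k (size s); last first.
    by rewrite [leRHS]nth_default//; have /andP[] := sg01 k.
  case: k ks => [|k] ks; first by have /andP[] := sg01 1%N.
  have sorted_s : sorted <=%O s by exact: sort_le_sorted.
  by apply: (le_sorted_leq_nth 1 sorted_s (x := k) (y := k.+1)); rewrite ?inE// ltnW.
have sg_mono : {homo sg : x y / (x <= y)%N >-> x <= y}.
  by apply: homo_leq => //; exact: le_trans.
have tel k : (k <= (size s).+1)%N ->
    \sum_(j < (size s).+1 | sg j < sg k) (sg j.+1 - sg j) = sg k.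
  move=> kn; transitivity (\sum_(j < k) (sg j.+1 - sg j)).
    rewrite (big_ord_widen _ (fun j => sg j.+1 - sg j) kn).
    rewrite big_mkcond [RHS]big_mkcond/=; apply: eq_bigr => j _.
    have [jk|kj] := ltnP j k; last by rewrite ltNge (sg_mono _ _ kj).
    (* Earlier atoms tied with [sg k] are filtered out of the sum, but their gap is zero. *)
    case: ltP => // kj; apply/esym/eqP; rewrite subr_eq0 eq_le sgS andbT.
    by apply: le_trans kj; exact: sg_mono.
  by rewrite -(big_mkord xpredT (fun j => sg j.+1 - sg j)) telescope_sumr// subr0.
exists (size s).+1, (fun j => sg j), (fun j => sg j.+1 - sg j); split => //.
- by move=> j; rewrite subr_ge0.
- rewrite -(big_mkord xpredT (fun j => sg j.+1 - sg j)) telescope_sumr//.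
  by rewrite sgn subr0.
- move=> i; have /(nthP 1)[k ks <-] := bs i.
  by apply: (tel k.+1); exact: ltnW.
Qed.

(* Each m is counted with weight q ^ (\sum_i m i - #|u| * mu) >= 1, which makes
   the sum factor; q = mu / (1 + mu) is the optimal choice. *)
Lemma card_bounded_sum (R : realType) (d L mu : nat) (u : {set 'I_d}) :
  (0 < mu)%N ->
  (#|[pred m : {ffun 'I_d -> 'I_L} |
     [forall (i | i \notin u), val (m i) == 0%N] && (\sum_i m i <= #|u| * mu)%N]|%:R : R)
  <= (expR 1 * (1 + mu%:R)) ^+ #|u|.
Proof.
move=> mu0; set A := [pred m | _].
have mu_gt0 : 0 < mu%:R :> R by rewrite ltr0n.
pose q : R := mu%:R / (1 + mu%:R).
have q0 : 0 < q by rewrite divr_gt0// addr_gt0.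
have q1 : q < 1 by rewrite ltr_pdivrMr ?addr_gt0// mul1r ltrDr.
have qE : (1 - q)^-1 = 1 + mu%:R.
  apply: (can_inj invrK); rewrite invrK /q; field.
  by rewrite gt_eqF// addr_gt0.
have qV : q^-1 = 1 + mu%:R^-1.
  by rewrite /q invf_div mulrDl mul1r divff ?gt_eqF// addrC.
clearbody q.
pose F (i : 'I_d) (j : 'I_L) : R :=
  if i \in u then q ^+ j else (val j == 0%N)%:R.
have F0 i j : 0 <= F i j by rewrite /F; case: ifP => _; rewrite ?exprn_ge0// ltW.
have Fsum i : \sum_j F i j <= if i \in u then (1 + mu%:R) else 1.
  rewrite /F; case: ifP => iu.
    rewrite -qE -[leRHS]mul1r ler_pdivlMr ?subr_gt0// mulrC.
    have := subrX1 q L; have : 0 <= q ^+ L by rewrite exprn_ge0// ltW.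
    by move: (q ^+ L) (\sum_(j < L) _) => y S; nra.
  clear F F0 A; case: L => [|L]; first by rewrite big_ord0.
  by rewrite big_ord_recl/= big1 ?addr0.
have -> : #|A|%:R = \sum_(m | A m) (1 : R) by rewrite sumr_const.
apply: (@le_trans _ _ (q ^- (#|u| * mu) *
    \sum_(m : {ffun 'I_d -> 'I_L}) \prod_i F i (m i))).
  rewrite mulr_sumr big_mkcond/=; apply: ler_sum => m _.
  case: ifP => [/andP[/forallP mu' ms]|_]; last first.
    by rewrite mulr_ge0 ?prodr_ge0// invr_ge0 exprn_ge0// ltW.
  have -> : \prod_i F i (m i) = q ^+ \sum_i m i.
    rewrite (big_morph _ (exprD q) (expr0 q)); apply: eq_bigr => i _; rewrite /F.
    case: ifPn => // iu; have /implyP/(_ iu)/eqP mi0 := mu' i.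
    by rewrite /= mi0.
  rewrite mulrC ler_pdivlMr ?exprn_gt0// mul1r.
  by apply: ler_wiXn2l => //; rewrite ltW.
rewrite -(bigA_distr_bigA F) exprMn/=; apply: ler_pM.
- by rewrite invr_ge0 exprn_ge0// ltW.
- by apply: prodr_ge0 => i _; apply: sumr_ge0.
(* Here [q^-mu = (1 + 1/mu)^mu <= e]. *)
- rewrite mulnC exprM -exprVn; apply: lerXn2r.
  + by rewrite nnegrE invr_ge0 exprn_ge0// ltW.
  + by rewrite nnegrE expR_ge0.
  have -> : expR 1 = expR (mu%:R^-1) ^+ mu :> R.
    by rewrite -expRM_natl divff// gt_eqF.
  rewrite -exprVn; apply: lerXn2r; rewrite ?nnegrE ?expR_ge0 ?invr_ge0//.
    exact: ltW.
  by rewrite qV; exact: expR_ge1Dx.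
- rewrite -prodr_const [leRHS]big_mkcond/=; apply: ler_prod => i _.
  by rewrite sumr_ge0//=; exact: Fsum.
Qed.

(** * Exponential grids and bracketing of boxes *)

(** Serves to cut an over-budget exponent vector down to the exact budget. Greedily, the first
    coordinate takes as much of [M] as it can and the truncated difference goes to the others. *)
Lemma exists_ffun_sum_eq (d M : nat) (m : 'I_d -> nat) :
  (M <= \sum_i m i)%N ->
  exists2 m' : 'I_d -> nat, (forall i, m' i <= m i)%N & (\sum_i m' i = M)%N.
Proof.
elim: d M m => [|d IH] M m.
  by rewrite big_ord0 leqn0 => /eqP ->; exists m => //; rewrite big_ord0.
rewrite big_ord_recl => Mm.
have [|m' m'm m'M] := IH (M - m ord0)%N (fun i => m (lift ord0 i)).
  by rewrite leq_subLR.
exists (fun i => if unlift ord0 i is Some j then m' j else minn M (m ord0)) => [i|].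
  by case: unliftP => [j ->|->]//; exact: geq_minr.
rewrite big_ord_recl unlift_none.
under eq_bigr do rewrite liftK.
by rewrite m'M; lia.
Qed.

(* For a subset of size s, the corners at level j are the points with
   coordinates exp(- m_i h), where h = mesh j / s and m is a vector of natural
   numbers of sum at most budget s j; the least box then has volume
   exp(- 8 * 2 ^ j), which is below mesh j. *)
Definition mesh {R : realType} (j : nat) : R := (16 * 4 ^+ j)^-1.

Definition budget (s j : nat) : nat := (s * (128 * 8 ^ j))%N.

Definition corner {R : realType} {d : nat} (s j : nat) (m : 'I_d -> nat)
    (i : 'I_d) : R := expR (- ((m i)%:R * (mesh j / s%:R))).

(** Division by 4 matches the ratio of consecutive meshes; rounding the exponent up moves the corner
    down, so the coarsened box is contained in the original one. *)
Definition coarsen {d : nat} (m : 'I_d -> nat) (i : 'I_d) : nat :=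
  ((m i + 3) %/ 4)%N.

Lemma mesh_gt0 (R : realType) j : 0 < mesh j :> R.
Proof. by rewrite invr_gt0 mulr_gt0// exprn_gt0. Qed.

Lemma mesh_le (R : realType) j : mesh j <= 1 / 16 :> R.
Proof.
rewrite /mesh invfM div1r ler_piMr// invf_le1 ?exprn_gt0// exprn_ege1//.
lra.
Qed.

Lemma meshS (R : realType) j : mesh j = 4 * mesh j.+1 :> R.
Proof. by rewrite /mesh exprS; field; rewrite gt_eqF// exprn_gt0. Qed.

Lemma budget_mesh (R : realType) s j : (0 < s)%N ->
  (budget s j)%:R * (mesh j / s%:R) = 8 * 2 ^+ j :> R.
Proof.
move=> s0; rewrite /budget !natrM natrX /mesh.
have -> : 8%:R = 4 * 2 :> R by rewrite -natrM.
have -> : 4%:R = 4 :> R by [].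
rewrite exprMn; field.
by rewrite gt_eqF ?ltr0n// gt_eqF ?exprn_gt0.
Qed.

Lemma mesh_pow2 (R : realType) j : mesh j * (16 * (2 ^+ j) ^+ 2) = 1 :> R.
Proof.
rewrite -exprM mulnC exprM -[2 ^+ 2]natrX mulVf//.
Qed.

(** As [8 y - 1 >= 7 y], the exponential dominates the cube of [exp(7/3 y) >= 1 + 7/3 y]. *)
Lemma expR_ge_square (R : realType) (y : R) :
  1 <= y -> 28 * y ^+ 2 <= expR (8 * y - 1).
Proof.
move=> y1; apply: (@le_trans _ _ (expR (3%:R * (7 / 3 * y)))); last first.
  by rewrite ler_expR; lra.
rewrite expRM_natl; apply: (@le_trans _ _ ((1 + 7 / 3 * y) ^+ 3)).
  nra.
by apply: lerXn2r; rewrite ?nnegrE ?expR_ge0 ?expR_ge1Dx//; lra.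
Qed.

(** Makes over-budget boxes negligible. The [- 1] absorbs rounding losses, which are small multiples
    of the mesh; the factor 3/4 turns [mesh j] into [3 * mesh j.+1], as [link_variance] needs. *)
Lemma expRN_le_mesh (R : realType) j :
  expR (- (8 * 2 ^+ j - 1)) <= 3 / 4 * mesh j :> R.
Proof.
have y1 : 1 <= 2 ^+ j :> R by rewrite exprn_ege1// ler1n.
have := expR_ge_square y1; have := mesh_pow2 R j; have := mesh_gt0 R j.
move: (mesh j) (2 ^+ j) y1 => h y y1 h0 hy e.
rewrite expRN -[leRHS]invrK lef_pV2 ?posrE ?expR_gt0 ?invr_gt0 ?mulr_gt0//.
have -> : (3 / 4 * h)^-1 = 64 / 3 * y ^+ 2.
  have h0' := lt0r_neq0 h0; apply: (mulfI (_ : 3 / 4 * h != 0)).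
    by rewrite mulf_neq0// mulf_neq0// invr_neq0.
  rewrite divff; last by rewrite mulf_neq0// mulf_neq0// invr_neq0.
  by lra.
by apply: le_trans e; nra.
Qed.

Section corners.
Context {R : realType} {d : nat}.
Implicit Types (m : 'I_d -> nat) (u : {set 'I_d}) (z : 'I_d -> R).

Lemma prod_corner s j m :
  \prod_i corner s j m i = expR (- ((\sum_i m i)%:R * (mesh j / s%:R))) :> R.
Proof.
rewrite /corner -expR_sum; congr expR.
by rewrite sumrN -mulr_suml natr_sum.
Qed.

Lemma le_corner s j m m' i : (m' i <= m i)%N -> corner s j m i <= corner s j m' i :> R.
Proof.
move=> mm'; rewrite ler_expR lerN2 ler_wpM2r ?ler_nat//.
by rewrite divr_ge0// ltW// mesh_gt0.
Qed.

Lemma le_corner_coarsen s j m i :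
  corner s j (coarsen m) i <= corner s j.+1 m i :> R.
Proof.
rewrite ler_expR lerN2 (meshS R j) -[4 * _ / _]mulrA [leRHS]mulrA.
apply: ler_wpM2r; first by rewrite divr_ge0// ltW// mesh_gt0.
by rewrite -natrM ler_nat /coarsen; lia.
Qed.

Lemma sum_coarsen u m : {in [predC u], m =1 fun=> 0%N} ->
  (4 * \sum_i coarsen m i <= \sum_i m i + 3 * #|u|)%N.
Proof.
move=> mu; rewrite big_distrr/= mulnC -sum_nat_const [X in (_ + X)%N]big_mkcond.
rewrite -big_split/=; apply: leq_sum => i _; rewrite /coarsen.
case: ifPn => [_|iu]; first lia.
by rewrite mu.
Qed.

(** The largest admissible [k] is taken. The cap [M] copes with [z = 0], which has no grid point
    below it. *)
Lemma exp_grid_point (h z : R) (M : nat) : 0 <= z <= 1 ->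
  exists k, [/\ (k <= M)%N, z <= expR (- (k%:R * h)) &
    (k < M)%N -> expR (- (k.+1%:R * h)) <= z].
Proof.
move=> /andP[z0 z1]; pose Q k := (k <= M)%N && (z <= expR (- (k%:R * h))).
have exQ : exists k, Q k by exists 0%N; rewrite /Q mul0r oppr0 expR0.
have ubQ k : Q k -> (k <= M)%N by case/andP.
case: (ex_maxnP exQ ubQ) => k /andP[kM zk] kmax; exists k; split => // ltkM.
rewrite leNgt; apply/negP => zk1; suff : (k.+1 <= k)%N by rewrite ltnn.
by apply: kmax; rewrite /Q ltkM ltW.
Qed.

(** Round every coordinate up to the grid, with exponents [m]; one further step on each coordinate
    of [u] gives a corner below [z]. The two volumes differ by the factor [exp(- mesh j)], hence by
    at most [mesh j]. When the budget does not allow this, the volume is itself at most [mesh j] and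
    the empty box can serve as lower bracket. *)
Lemma bracketing u j z (s := #|u|) : (0 < s)%N ->
  (forall i, 0 <= z i <= 1) -> (forall i, i \notin u -> z i = 1) ->
  (exists2 m, {in [predC u], m =1 fun=> 0%N} /\ (\sum_i m i <= budget s j)%N &
    (forall i, z i <= corner s j m i) /\
    \prod_i corner s j m i <= \prod_i z i + mesh j) /\
  (\prod_i z i <= mesh j \/
   exists2 m, {in [predC u], m =1 fun=> 0%N} /\ (\sum_i m i <= budget s j)%N &
    (forall i, corner s j m i <= z i) /\
    \prod_i z i <= \prod_i corner s j m i + mesh j).
Proof.
move=> s0 z01 zu.
have sR : 0 < s%:R :> R by rewrite ltr0n.
have hs : mesh j = s%:R * (mesh j / s%:R) :> R by rewrite mulrC mulfVK ?gt_eqF.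
have h0 := mesh_gt0 R j.
have prodz0 : 0 <= \prod_i z i by apply: prodr_ge0 => i _; have /andP[] := z01 i.
(* The slack [s] pays for the extra step on each coordinate of [u]: it changes the exponent by
   [mesh j] only. *)
have small k : (budget s j <= k + s)%N ->
    expR (- (k%:R * (mesh j / s%:R))) <= mesh j :> R.
  move=> Mk; apply: (@le_trans _ _ (expR (- (8 * 2 ^+ j - mesh j)))); last first.
    have := expRN_le_mesh R j; have := mesh_le R j;
    suff : expR (- (8 * 2 ^+ j - mesh j)) <= expR (- (8 * 2 ^+ j - 1)) :> R by lra.
    by rewrite ler_expR; have := mesh_le R j; lra.
  rewrite ler_expR lerN2 -(budget_mesh R j s0) {2}hs -mulrBl.
  by rewrite ler_wpM2r ?divr_ge0 ?(ltW h0)// lerBlDr -natrD ler_nat.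
have /choice[m hm] i : exists k, [/\ (k <= budget s j)%N, (i \notin u -> k = 0%N),
    z i <= expR (- (k%:R * (mesh j / s%:R))) & i \in u -> (k < budget s j)%N ->
      expR (- (k.+1%:R * (mesh j / s%:R))) <= z i].
  have [k [kM zk kz]] := exp_grid_point (mesh j / s%:R) (budget s j) (z01 i).
  have [iu|iu] := boolP (i \in u); first by exists k; split.
  by exists 0%N; split => //; rewrite mul0r oppr0 expR0 zu.
have zm i : z i <= corner s j m i by have [] := hm i.
have mu : {in [predC u], m =1 fun=> 0%N} by move=> i iu; have [_ ->] := hm i.
have le_prodz m' : (forall i, m' i <= m i)%N ->
    \prod_i z i <= \prod_i corner s j m' i.
  move=> m'm; apply: ler_prod => i _; have /andP[-> _]/= := z01 i.
  exact: le_trans (zm i) (le_corner _ _ (m'm i)).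
have [Mm|mM] := leqP (budget s j) (\sum_i m i)%N.
  have [m' m'm m'M] := exists_ffun_sum_eq Mm.
  have cm' : \prod_i corner s j m' i <= mesh j :> R.
    by rewrite prod_corner m'M small// leq_addr.
  split; last by left; exact: le_trans (le_prodz _ m'm) cm'.
  exists m'; split.
  - by move=> i iu; apply/eqP; rewrite -leqn0 -(mu i iu).
  - by rewrite m'M.
  - by move=> i; exact: le_trans (zm i) (le_corner _ _ (m'm i)).
  - by rewrite ler_wpDl.
pose m1 i := (m i + (i \in u))%N.
have m1z i : corner s j m1 i <= z i.
  rewrite /m1 /corner; have [iu|iu] := boolP (i \in u); last first.
    by rewrite mu// mul0r oppr0 expR0 zu.
  have [_ _ _ mz] := hm i; rewrite addn1; apply: mz => //.
  apply: leq_ltn_trans mM; rewrite (bigD1 i)//=; exact: leq_addr.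
have sm1 : (\sum_i m1 i = \sum_i m i + s)%N.
  rewrite big_split/= /s -sum1_card [X in _ = (_ + X)%N]big_mkcond/=.
  by congr (_ + _)%N; apply: eq_bigr => i _; case: (i \in u).
have cm1 : \prod_i corner s j m i <= \prod_i corner s j m1 i + mesh j :> R.
  rewrite !prod_corner sm1 natrD mulrDl -hs opprD expRD.
  set E := expR _; have E0 : 0 <= E by exact: expR_ge0.
  have E1 : E <= 1 by rewrite expR_le1 oppr_le0 mulr_ge0// divr_ge0// ltW.
  have := expR_ge1Dx (- mesh j : R); move: (expR _) => F; nra.
split.
  exists m; first by split => //; exact: ltnW.
  split => //; apply: le_trans cm1 _; rewrite lerD2r.
  by apply: ler_prod => i _; rewrite expR_ge0 m1z.
(* If [m] is within budget but [m1] is not, then [m] is within [s] of the budget and [small]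
   applies. *)
have [Mm1|Mm1] := leqP (\sum_i m i + s)%N (budget s j); last first.
  left; apply: le_trans (le_prodz _ (fun=> leqnn _)) _.
  by rewrite prod_corner small// ltnW.
right; exists m1; first split.
- by move=> i iu; rewrite /m1 mu// (negbTE iu).
- by rewrite sm1.
- by split => //; apply: le_trans cm1; exact: le_prodz.
Qed.

End corners.

(** * Chaining: variances of the links and deviations of arbitrary boxes *)

Section chaining.
Context {R : realType} {d n : nat} (pt w : 'I_n -> R).
Implicit Types (m : 'I_d -> nat) (u : {set 'I_d}) (c : 'I_d -> R).

Definition weight (t : {ffun 'I_d -> 'I_n}) : R := \prod_i w (t i).

Definition in_box c : pred {ffun 'I_d -> 'I_n} :=
  fun t => [forall i, pt (t i) < c i].

Definition mass (f : pred {ffun 'I_d -> 'I_n}) : R := \sum_(t | f t) weight t.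

(* The increment of the chain: a box at level j minus its coarsening at level
   j.-1, the latter replaced by the empty box when it is over budget. *)
Definition link s j m : pred {ffun 'I_d -> 'I_n} := fun t =>
  in_box (corner s j m) t &&
  ~~ (if j is j'.+1 then
        (\sum_i coarsen m i <= budget s j')%N &&
        in_box (corner s j' (coarsen m)) t
      else false).

Lemma mass_in_box c : mass (in_box c) = \prod_i \sum_(j | pt j < c i) w j.
Proof.
rewrite (bigA_distr_big_dep (fun i j => pt j < c i) (fun i j => w j)).
by apply: eq_bigl => t; apply/forallP/familyP.
Qed.

Context (w_ge0 : forall j, 0 <= w j) (w_sum1 : \sum_j w j = 1).

Lemma weight_ge0 t : 0 <= weight t.
Proof. exact: prodr_ge0. Qed.

Lemma weight_sum1 : \sum_t weight t = 1.
Proof.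
rewrite /weight -(bigA_distr_bigA (fun (_ : 'I_d) j => w j)) w_sum1.
by rewrite prodr_const expr1n.
Qed.

Lemma mass_ge0 f : 0 <= mass f.
Proof. by apply: sumr_ge0 => t _; exact: weight_ge0. Qed.

Lemma in_boxS c c' t : (forall i, c' i <= c i) -> in_box c' t -> in_box c t.
Proof.
by move=> cc' /forallP h; apply/forallP => i; exact: lt_le_trans (h i) (cc' i).
Qed.

Lemma linkE s j m t : (in_box (corner s j.+1 m) t)%:R = (link s j.+1 m t)%:R +
  (if (\sum_i coarsen m i <= budget s j)%N then
     (in_box (corner s j (coarsen m)) t)%:R else 0) :> R.
Proof.
rewrite /link; case: ifP => _ /=; last by rewrite andbT addr0.
have [h|h] := boolP (in_box (corner s j (coarsen m)) t).
  rewrite andbF add0r (in_boxS _ h)// => i; exact: le_corner_coarsen.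
by rewrite andbT addr0.
Qed.

Context {s J : nat} (u : {set 'I_d}) (us : #|u| = s) (s_gt0 : (0 < s)%N).
Context (exact_corner : forall j k, (j <= J)%N -> (k <= budget s j)%N ->
  let c := expR (- (k%:R * (mesh j / s%:R))) in \sum_(l | pt l < c) w l = c).

Lemma mass_corner j m : (j <= J)%N -> (\sum_i m i <= budget s j)%N ->
  mass (in_box (corner s j m)) = \prod_i corner s j m i.
Proof.
move=> jJ mb; rewrite mass_in_box; apply: eq_bigr => i _.
apply: exact_corner => //; apply: leq_trans mb.
by rewrite (bigD1 i)//= leq_addr.
Qed.

Lemma mass_linkS j m :
  mass (in_box (corner s j.+1 m)) = mass (link s j.+1 m) +
  (if (\sum_i coarsen m i <= budget s j)%N then
     mass (in_box (corner s j (coarsen m))) else 0).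
Proof.
have massE f : mass f = \sum_t weight t * (f t)%:R.
  rewrite /mass big_mkcond/=; apply: eq_bigr => t _.
  by case: (f t); rewrite ?mulr1 ?mulr0.
rewrite !massE; under [LHS]eq_bigr do rewrite linkE mulrDr.
rewrite big_split/=; case: ifP => // _; congr (_ + _).
by rewrite big1// => t _; rewrite mulr0.
Qed.

(** At level 0, [4 * mesh 0] is 1/4, the largest variance of an indicator. At level [j.+1] the mass
    is at most [3 * mesh j.+1]: coarsening within budget raises the exponent of the volume by at
    most that much, and coarsening over budget means that the whole box is already that small. *)
Lemma link_variance j m : (j <= J)%N -> {in [predC u], m =1 fun=> 0%N} ->
  (\sum_i m i <= budget s j)%N ->
  mass (link s j m) * (1 - mass (link s j m)) <= 4 * mesh j.
Proof.
move=> jJ mu mb; case: j jJ mb => [|j] jJ mb.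
  have -> : 4 * mesh 0 = 1 / 4 :> R by rewrite /mesh expr0 mulr1; field.
  move: (mass _) => p; have : 0 <= (p - 1 / 2) ^+ 2 by exact: sqr_ge0.
  by nra.
suff : mass (link s j.+1 m) <= 3 * mesh j.+1.
  have := mesh_gt0 R j.+1; have := mass_ge0 (link s j.+1 m).
  by move: (mass _) (mesh _) => p h; nra.
have sR : 0 < s%:R :> R by rewrite ltr0n.
have h0 := mesh_gt0 R j.+1.
set g : R := mesh j.+1 / s%:R.
have g0 : 0 < g by rewrite divr_gt0.
have hs : mesh j.+1 = s%:R * g by rewrite mulrC mulfVK ?gt_eqF.
have hjs : mesh j / s%:R = 4 * g by rewrite (meshS R j) mulrA.
have cb : 4 * (\sum_i coarsen m i)%:R <= (\sum_i m i)%:R + 3 * s%:R :> R.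
  by have := sum_coarsen mu; rewrite us -(ler_nat R) natrD !natrM.
have := mass_linkS j m; rewrite mass_corner//; case: ifPn => [cM|].
  rewrite mass_corner ?(ltnW jJ)// !prod_corner hjs -/g => /eqP.
  rewrite -subr_eq => /eqP <-.
  set a := _ * g; set b := _ * (4 * g).
  (* From [sum_coarsen]: rounding costs at most 3 fine steps on each of the [s] coordinates. *)
  have ab : b <= a + 3 * (s%:R * g) by rewrite /a /b; nra.
  have -> : - b = - a + (a - b) by lra.
  rewrite expRD; have := expR_ge1Dx (a - b); rewrite hs.
  have : expR (- a) <= 1.
    by rewrite expR_le1 oppr_le0 mulr_ge0// ltW.
  have : 0 < s%:R * g by rewrite mulr_gt0.
  have := expR_gt0 (- a); move: (expR _) (expR _) => E F; nra.
rewrite -ltnNge -(ltr_nat R) => cM; rewrite addr0 => <-.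
rewrite prod_corner -/g.
have -> : 3 * mesh j.+1 = 3 / 4 * mesh j :> R by rewrite (meshS R j); lra.
apply: le_trans (expRN_le_mesh R j); rewrite ler_expR lerN2.
rewrite -(budget_mesh R j s_gt0) hjs.
have := mesh_le R j.+1; rewrite hs; nra.
Qed.

(** Triangle inequality along the chain, by induction on the level. A coarsening over budget ends
    the chain in the empty box, whose deviation is zero. *)
Lemma chaining (N : nat) (x : 'I_N -> {ffun 'I_d -> 'I_n}) (a : nat -> R)
    (dev := fun f : pred {ffun 'I_d -> 'I_n} => `|\sum_k (f (x k))%:R - N%:R * mass f|) :
  (forall j, 0 <= a j) ->
  (forall j m, (j <= J)%N -> {in [predC u], m =1 fun=> 0%N} ->
    (\sum_i m i <= budget s j)%N -> dev (link s j m) <= a j) ->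
  forall j m, (j <= J)%N -> {in [predC u], m =1 fun=> 0%N} ->
    (\sum_i m i <= budget s j)%N ->
    dev (in_box (corner s j m)) <= \sum_(0 <= i < j.+1) a i.
Proof.
move=> a0 dev_link; elim=> [|j IH] m jJ mu mb.
  rewrite big_nat1 (_ : in_box _ = link s 0 m); first exact: dev_link.
  by apply/funext => t; rewrite /link andbT.
rewrite big_nat_recr//= addrC.
have cu : {in [predC u], coarsen m =1 fun=> 0%N}.
  by move=> i iu; rewrite /coarsen mu.
rewrite /dev (eq_bigr _ (fun k _ => linkE s j m (x k))) mass_linkS//.
rewrite big_split/= mulrDr opprD addrACA.
apply: le_trans (ler_normD _ _) _; apply: lerD; first exact: dev_link.
case: ifP => [cb|_]; first by apply: IH => //; exact: ltnW.
rewrite big1// mulr0 subr0 normr0; exact: sumr_ge0.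
Qed.

(** The count is monotone in the box, so it lies between the counts of the two brackets at level
    [J]; their volumes contribute the error [N * mesh J], their chains the sum of the [a j]. *)
Lemma deviation_le (N : nat) (x : 'I_N -> {ffun 'I_d -> 'I_n}) (a : nat -> R)
    (z : 'I_d -> R) :
  (forall j, 0 <= a j) ->
  (forall j m, (j <= J)%N -> {in [predC u], m =1 fun=> 0%N} ->
    (\sum_i m i <= budget s j)%N ->
    `|\sum_k (link s j m (x k))%:R - N%:R * mass (link s j m)| <= a j) ->
  (forall i, 0 <= z i <= 1) -> (forall i, i \notin u -> z i = 1) ->
  `|\sum_k (in_box z (x k))%:R - N%:R * \prod_i z i| <=
    N%:R * mesh J + \sum_(0 <= j < J.+1) a j.
Proof.
move=> a0 dev_link z01 zu.
have corner_dev m : {in [predC u], m =1 fun=> 0%N} -> (\sum_i m i <= budget s J)%N ->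
    `|\sum_k (in_box (corner s J m) (x k))%:R - N%:R * \prod_i corner s J m i| <=
    \sum_(0 <= j < J.+1) a j.
  by move=> mu mb; rewrite -mass_corner//; exact: chaining.
have count_le (c c' : 'I_d -> R) : (forall i, c i <= c' i) ->
    \sum_k (in_box c (x k))%:R <= \sum_k (in_box c' (x k))%:R :> R.
  move=> cc'; apply: ler_sum => k _; rewrite ler_nat.
  by have := in_boxS (t := x k) cc'; case: (in_box c _) => // ->.
have N0 : 0 <= N%:R :> R by [].
have h0 := mesh_gt0 R J.
have s0 : (0 < #|u|)%N by rewrite us.
have [[m [mu mb] [zm pm]] lower] := bracketing J s0 z01 zu.
rewrite us in mb zm pm lower.
rewrite ler_distl; apply/andP; split; last first.
  have := corner_dev _ mu mb; rewrite ler_distl => /andP[_ up].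
  apply: le_trans (count_le _ _ zm) _; apply: le_trans up _.
  by rewrite addrA lerD2r -mulrDr; exact: ler_wpM2l.
(* Without a lower corner the lower bound to be shown is at most 0, and counts are non-negative. *)
case: lower => [zsmall|[m' [mu' mb'] [zm' pm']]].
  apply: (@le_trans _ _ 0); last exact: sumr_ge0.
  rewrite subr_le0; apply: ler_wpDr; first by apply: sumr_ge0 => j _; exact: a0.
  by exact: ler_wpM2l.
have := corner_dev _ mu' mb'; rewrite ler_distl => /andP[lo _].
apply: le_trans (le_trans lo (count_le _ _ zm')).
by rewrite opprD addrA lerD2r lerBlDr -mulrDr; exact: ler_wpM2l.
Qed.

End chaining.

(** * Numerical constants and the union bound *)

Lemma sum_half (R : realType) (K : nat) :
  \sum_(j < K) (1 / 2) ^+ j.+1 = 1 - (1 / 2) ^+ K :> R.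
Proof.
elim: K => [|K IH]; first by rewrite big_ord0 expr0 subrr.
by rewrite big_ord_recr/= IH !exprS; lra.
Qed.

(** With [y = s/d], one binomial term gives [C(d,s) y^s <= (1 + y)^d <= exp(y d) = exp(s)]. *)
Lemma bin_le_pow (R : realType) (d s : nat) : (0 < s)%N -> (s <= d)%N ->
  'C(d, s)%:R <= (expR 1 * d%:R / s%:R) ^+ s :> R.
Proof.
move=> s0 sd; have d0 : (0 < d)%N by exact: leq_trans sd.
have sR : 0 < s%:R :> R by rewrite ltr0n.
have dR : 0 < d%:R :> R by rewrite ltr0n.
set y : R := s%:R / d%:R.
have y0 : 0 < y by rewrite divr_gt0.
have -> : expR 1 * d%:R / s%:R = expR 1 / y :> R by rewrite /y; field; rewrite !gt_eqF.
have yd : d%:R * y = s%:R by rewrite mulrC divfK ?gt_eqF.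
clearbody y.
rewrite expr_div_n ler_pdivlMr ?exprn_gt0//.
apply: (@le_trans _ _ ((1 + y) ^+ d)).
  have sd1 : (s < d.+1)%N by [].
  rewrite exprDn (bigD1 (Ordinal sd1))//= expr1n mul1r mulr_natl.
  rewrite lerDl; apply: sumr_ge0 => i _.
  by rewrite expr1n mul1r mulrn_wge0// exprn_ge0// ltW.
rewrite -expRM_natl mulr1 -yd expRM_natl; apply: lerXn2r.
- by rewrite nnegrE addr_ge0// ltW.
- by rewrite nnegrE expR_ge0.
- exact: expR_ge1Dx.
Qed.

(** Here 16 is 8 times 2: each level multiplies the budget by 8 and must leave a factor 1/2. *)
Lemma expR3_ge16 (R : realType) : 16 <= expR 3 :> R.
Proof.
have -> : 3 = 24%:R * (1 / 8) :> R by field.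
rewrite expRM_natl; apply: (@le_trans _ _ ((9 / 8) ^+ 24)).
  rewrite (_ : 24 = 3 * 2 * 2 * 2)%N// !exprM.
  have y1 : 142 / 100 <= (9 / 8) ^+ 3 :> R by rewrite !exprS expr0; lra.
  have y2 : 2 <= ((9 / 8) ^+ 3) ^+ 2 :> R by nra.
  have y4 : 4 <= (((9 / 8) ^+ 3) ^+ 2) ^+ 2 :> R by nra.
  nra.
apply: lerXn2r; rewrite ?nnegrE ?expR_ge0//.
by have := expR_ge1Dx (1 / 8 : R); lra.
Qed.

(** Here 1032 is 129 times 8: 129 comes from [1 + 128 * 8^j <= 129 * 8^j], and 8 leaves three
    halvings per coordinate. *)
Lemma expR9_ge (R : realType) : 1032 * expR 1 <= expR 9 :> R.
Proof.
have -> : 9 = (3 + 3 + 4%:R * (1 / 2)) + 1 :> R by lra.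
rewrite expRD ler_wpM2r ?expR_ge0// (expRD (3 + 3)) (expRD 3) expRM_natl.
have e3 := expR3_ge16 R.
have e2 : 5 <= expR (1 / 2 : R) ^+ 4.
  apply: (@le_trans _ _ ((3 / 2) ^+ 4)); first lra.
  apply: lerXn2r; rewrite ?nnegrE ?expR_ge0//.
  by have := expR_ge1Dx (1 / 2 : R); lra.
have e6 : 256 <= expR 3 * expR 3 :> R by nra.
by apply: le_trans (ler_pM _ _ e6 e2); lra.
Qed.

(** Failure probability per corner times the bound of [card_bounded_sum] on the number of corners.
    What remains is [exp(- s l)], to be spent on the choice of the subset, and powers of 1/2 that
    are summable over sizes and levels. *)
Lemma cells_le (R : realType) (s j : nat) (l : R) : (0 < s)%N ->
  2 * expR (- (s%:R * (l + 9 + 3 * j%:R))) *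
    (expR 1 * (1 + (128 * 8 ^ j)%:R)) ^+ s <=
  expR (- (s%:R * l)) * (1 / 2) ^+ s * (1 / 2) ^+ j.+1.
Proof.
move=> s0.
have base : expR 1 * (1 + (128 * 8 ^ j)%:R) <=
    expR (9 + 3 * j%:R) * (1 / 2) ^+ (3 + j) :> R.
  have p8 : 1 <= 8 ^+ j :> R by rewrite exprn_ege1// ler1n.
  have e3j : 8 ^+ j <= expR (3 * j%:R) * (1 / 2) ^+ j :> R.
    rewrite expRM_natr -exprMn; apply: lerXn2r; rewrite ?nnegrE//.
    by have := expR3_ge16 R; lra.
  rewrite expRD exprD natrM natrX mulrACA.
  apply: (@le_trans _ _ (expR 1 * (129 * 8 ^+ j))).
    by rewrite ler_wpM2l ?expR_ge0//; lra.
  rewrite mulrA; apply: ler_pM => //.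
  by have := expR9_ge R; rewrite !exprS expr0; lra.
apply: (@le_trans _ _ (2 * expR (- (s%:R * (l + 9 + 3 * j%:R))) *
    (expR (9 + 3 * j%:R) * (1 / 2) ^+ (3 + j)) ^+ s)).
  rewrite ler_wpM2l ?mulr_ge0 ?expR_ge0//.
  by apply: lerXn2r; rewrite // nnegrE mulr_ge0 ?expR_ge0.
rewrite exprMn -expRM_natl -exprM -[leRHS]mulrA -exprD.
have -> : expR (- (s%:R * l)) =
    expR (- (s%:R * (l + 9 + 3 * j%:R))) * expR (s%:R * (9 + 3 * j%:R)) :> R.
  by rewrite -expRD; congr expR; ring.
set a := expR (- _); set b := expR _; set c := _ ^+ (_ * _).
rewrite (_ : 2 * a * (b * c) = a * b * (2 * c)); last by ring.
rewrite ler_wpM2l ?mulr_ge0 ?expR_ge0// {}/c.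
apply: (@le_trans _ _ (2 * (1 / 2) ^+ (s + j.+1).+1)); last by rewrite exprS; lra.
(* The exponent inequality is [s + j + 2 <= (3 + j) s], valid as [s >= 1]. *)
by rewrite ler_wpM2l//; apply: ler_wiXn2l; [lra|lra|nia].
Qed.

(** Take the least [J] with [6 D 4^J >= 1], which says [mesh J <= 3/8 D]. Minimality bounds
    [D (12/5)^J], so that the parameters [lambda] of the exponential moments stay at most 1/2. *)
Lemma exists_level (R : realType) (D : R) : 0 < D < 1 ->
  exists J, mesh J <= 3 / 8 * D /\ forall j, (j <= J)%N -> D * (12 / 5) ^+ j <= 1.
Proof.
move=> /andP[D0 D1]; pose Q J := 1 <= 6 * D * 4 ^+ J.
have exQ : exists J, Q J.
  exists (Num.bound (6 * D)^-1); rewrite /Q -ler_pdivrMl ?mulr_gt0// mulr1.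
  have h : (6 * D)^-1 <= (Num.bound (6 * D)^-1)%:R.
    by rewrite ltW// archi_boundP// invr_ge0 mulr_ge0// ltW.
  apply: le_trans h _; rewrite -natrX ler_nat ltnW// ltn_expl//.
case: (ex_minnP exQ) => J QJ Jmin; exists J; split.
  have h := mesh_gt0 R J; rewrite -[leLHS]mulr1.
  have -> : 3 / 8 * D = mesh J * (6 * D * 4 ^+ J).
    by rewrite /mesh; field; rewrite gt_eqF// exprn_gt0.
  by rewrite ler_wpM2l// ltW.
move=> j; case: J QJ Jmin => [_ _|J _ Jmin].
  by rewrite leqn0 => /eqP ->; rewrite expr0 mulr1 ltW.
move=> jJ; have : ~~ Q J by apply/negP => /Jmin; rewrite ltnn.
rewrite /Q -ltNge => QJ.
apply: (@le_trans _ _ (D * (12 / 5) ^+ J.+1)).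
  rewrite ler_wpM2l ?(ltW D0)//; apply: ler_weXn2l => //; lra.
have : (12 / 5) ^+ J <= 4 ^+ J :> R by apply: lerXn2r; rewrite ?nnegrE//; lra.
rewrite exprS; move: ((12 / 5) ^+ J) (4 ^+ J) QJ => p q QJ pq; nra.
Qed.

(** This [lambda] is the minimiser [D alpha / (2 v)]; the minimum is [- N D^2 (36/25)^j / 16], where
    36/25 is 4 times the square of 3/5. Bernoulli's inequality for [(36/25)^j] and [l >= 1] finish
    the estimate. *)
Lemma exponent_le (R : realType) (N s D l : R) (j : nat)
    (alpha := (1 / 4) * (3 / 5) ^+ j) (v := 4 * mesh j)
    (lambda := D * (12 / 5) ^+ j / 2) :
  1 <= l -> 0 <= s -> N * D ^+ 2 = 3249 / 100 * (49 / 10 + 2 * l) * s ->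
  N * (lambda ^+ 2 * v) - lambda * (N * D * alpha) <= - (s * (l + 9 + 3 * j%:R)).
Proof.
move=> l1 s0 ND.
have h144 : 1 + 44 / 100 * j%:R <= (36 / 25) ^+ j :> R.
  elim: j {alpha v lambda} => [|j IH]; first by rewrite mulr0 addr0 expr0.
  have j0 : 0 <= j%:R :> R by [].
  by rewrite exprS -natr1; nra.
have e1 : (12 / 5) ^+ j * (3 / 5) ^+ j = (36 / 25) ^+ j :> R.
  by rewrite -exprMn; congr (_ ^+ _); lra.
have e2 : ((12 / 5) ^+ j) ^+ 2 * mesh j = (36 / 25) ^+ j / 16 :> R.
  have -> : ((12 / 5) ^+ j) ^+ 2 = (36 / 25) ^+ j * 4 ^+ j :> R.
    by rewrite -exprM mulnC exprM -exprMn; congr (_ ^+ _); lra.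
  by rewrite /mesh; field; rewrite gt_eqF// exprn_gt0.
have -> : N * (lambda ^+ 2 * v) - lambda * (N * D * alpha) =
    N * D ^+ 2 * (((12 / 5) ^+ j) ^+ 2 * mesh j - (12 / 5) ^+ j * (3 / 5) ^+ j / 8).
  by rewrite /lambda /v /alpha; field.
rewrite e1 e2 ND; have j0 : 0 <= j%:R :> R by [].
move: (_ ^+ j) (j%:R) h144 j0 => q i qi i0.
rewrite lerNr (_ : - _ = s * (3249 / 1600 * (49 / 10 + 2 * l) * q)); last by field.
apply: ler_wpM2l => //.
apply: (@le_trans _ _ (3249 / 1600 * (49 / 10 + 2 * l) * (1 + 44 / 100 * i))); first nra.
apply: ler_wpM2l; last exact: qi.
by lra.
Qed.

Lemma sum_geometric_le (R : realType) (J : nat) :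
  \sum_(0 <= j < J) 1 / 4 * (3 / 5) ^+ j <= 5 / 8 :> R.
Proof.
suff -> : \sum_(0 <= j < J) 1 / 4 * (3 / 5) ^+ j = 5 / 8 * (1 - (3 / 5) ^+ J) :> R.
  have : 0 <= (3 / 5) ^+ J :> R by rewrite exprn_ge0//; lra.
  by lra.
elim: J => [|J IH]; first by rewrite big_nil expr0 subrr mulr0.
by rewrite big_nat_recr//= IH exprS; field.
Qed.

Lemma sum_nonempty_card (R : realType) (d : nat) (phi : nat -> R) :
  \sum_(u : {set 'I_d} | u != finset.set0) phi #|u| =
  \sum_(s < d) 'C(d, s.+1)%:R * phi s.+1.
Proof.
have cd (u : {set 'I_d}) : (#|u| < d.+1)%N.
  by rewrite ltnS -[leqRHS]card_ord max_card.
rewrite (partition_big (fun u => Ordinal (cd u)) (fun s => s != ord0)) /=; last first.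
  by move=> u; rewrite -cards_eq0.
rewrite big_mkcond big_ord_recl/= add0r; apply: eq_bigr => s _.
rewrite -[d in 'C(d, _)]card_ord -card_draws.
rewrite (eq_bigr (fun=> phi s.+1)) => [|u /andP[_ /eqP[->]]//].
rewrite sumr_const mulr_natl; congr (_ *+ _); apply: eq_card => u.
rewrite !inE; apply/andP/eqP => [[_ /eqP[]//]|us].
by split; [rewrite -cards_eq0 us|apply/eqP/val_inj].
Qed.

Section union.
Context {R : realType} (d : nat).

Definition entropy (s : nat) : R := ln (expR 1 * d%:R / s%:R).

Lemma entropy_ge1 s : (0 < s <= d)%N -> 1 <= entropy s.
Proof.
move=> /andP[s0 sd]; rewrite -ler_expR lnK.
  rewrite -mulrA ler_peMr ?expR_ge0// ler_pdivlMr ?ltr0n// mul1r ler_nat//.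
by rewrite posrE divr_gt0// ?ltr0n// mulr_gt0 ?expR_gt0// ltr0n (leq_trans s0).
Qed.

Lemma bin_entropy s : (0 < s <= d)%N ->
  'C(d, s)%:R * expR (- (s%:R * entropy s)) <= 1.
Proof.
move=> /andP[s0 sd].
have pos : 0 < expR 1 * d%:R / s%:R :> R.
  by rewrite divr_gt0// ?ltr0n// mulr_gt0 ?expR_gt0// ltr0n (leq_trans s0).
rewrite expRN expRM_natl lnK// ler_pdivrMr ?exprn_gt0// mul1r.
exact: bin_le_pow.
Qed.

(** Summing over [m] uses [cells_le], the levels form a geometric series, and the binomial
    coefficient is cancelled by [exp(- s l)]. The total is at most [1 - (1/2)^d], whatever the
    truncations [K] and [L]. *)
Lemma union_bound (K L : nat) :
  \sum_(u : {set 'I_d} | u != finset.set0) \sum_(j < K)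
    \sum_(m : {ffun 'I_d -> 'I_L} |
        [forall (i | i \notin u), val (m i) == 0%N] &&
        (\sum_i m i <= budget #|u| j)%N)
      2 * expR (- (#|u|%:R * (entropy #|u| + 9 + 3 * j%:R))) < 1 :> R.
Proof.
pose phi s := expR (- (s%:R * entropy s)) * (1 / 2) ^+ s : R.
have phi0 s : 0 <= phi s by rewrite mulr_ge0 ?expR_ge0.
apply: (@le_lt_trans _ _ (\sum_(u : {set 'I_d} | u != finset.set0) phi #|u|)).
  apply: ler_sum => u u0; have s0 : (0 < #|u|)%N by rewrite card_gt0.
  apply: (@le_trans _ _ (\sum_(j < K) phi #|u| * (1 / 2) ^+ j.+1)); last first.
    by rewrite -mulr_sumr sum_half ler_piMr.
  apply: ler_sum => j _; apply: le_trans (cells_le j (entropy #|u|) s0).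
  rewrite sumr_const -[leLHS]mulr_natr ler_wpM2l ?mulr_ge0 ?expR_ge0//.
  apply: le_trans (card_bounded_sum R L u _); last first.
    by rewrite muln_gt0 expn_gt0.
  by rewrite ler_nat.
rewrite sum_nonempty_card.
apply: (@le_lt_trans _ _ (\sum_(s < d) (1 / 2) ^+ s.+1)).
  apply: ler_sum => s _; rewrite /phi mulrA ler_piMl ?bin_entropy//.
  exact: ltn_ord.
rewrite sum_half; have : 0 < (1 / 2) ^+ d :> R by rewrite exprn_gt0//; lra.
by lra.
Qed.
End union.

(** * Choice of the points and conclusion *)

Definition target {R : realType} (d N s : nat) : R :=
  57 / 10 / Num.sqrt N%:R *
    (Num.sqrt (49 / 10 + 2 * entropy d s) * Num.sqrt s%:R).

Lemma target_sqr (R : realType) (d N s : nat) : (0 < N)%N -> (0 < s <= d)%N ->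
  N%:R * (target d N s) ^+ 2 =
  3249 / 100 * (49 / 10 + 2 * entropy d s) * s%:R :> R.
Proof.
move=> N0 sd; rewrite /target !exprMn !exprVn !sqr_sqrtr//; last first.
  by have : 1 <= entropy d s :> R := entropy_ge1 sd; lra.
by field; rewrite gt_eqF// ltr0n.
Qed.

Lemma target_gt0 (R : realType) (d N s : nat) : (0 < N)%N -> (0 < s <= d)%N ->
  0 < target d N s :> R.
Proof.
move=> N0 sd; have /andP[s0 _] := sd.
apply: mulr_gt0.
  by apply: divr_gt0; [lra|rewrite sqrtr_gt0 ltr0n].
rewrite mulr_gt0 ?sqrtr_gt0 ?ltr0n//.
by have : 1 <= entropy d s :> R := entropy_ge1 sd; lra.
Qed.

(** Points are kept as vectors of atom indices. One sample must serve all subsets and levels at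
    once, so a single finite law is made exact on every grid coordinate involved. *)
Lemma exists_grid_points (R : realType) (d N : nat) : (0 < N)%N ->
  exists (n : nat) (pt : 'I_n -> R) (x : 'I_N -> {ffun 'I_d -> 'I_n}),
    (forall j, 0 <= pt j <= 1) /\
    forall u : {set 'I_d}, u != finset.set0 -> target d N #|u| < 1 :> R ->
    forall z : 'I_d -> R, (forall i, 0 <= z i <= 1) ->
      (forall i, i \notin u -> z i = 1) ->
      `|\sum_k (in_box pt z (x k))%:R - N%:R * \prod_i z i| <=
        N%:R * target d N #|u|.
Proof.
move=> N0; have NR : 0 < N%:R :> R by rewrite ltr0n.
have /choice[lev levP] s : exists J, (0 < s <= d)%N -> target d N s < 1 :> R ->
    mesh J <= 3 / 8 * target d N s :> R /\
    forall j, (j <= J)%N -> target d N s * (12 / 5) ^+ j <= 1 :> R.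
  have [sd|] := boolP (0 < s <= d)%N; last by exists 0%N.
  have [D1|D1] := ltP (target d N s : R) 1; last by exists 0%N.
  have [|J JP] := @exists_level R (target d N s); last by exists J.
  by rewrite target_gt0.
(* [K] exceeds every level in use and [L] bounds every exponent, so that all coordinates and
   constraints are indexed by finite types. *)
pose K := (\max_(s < d.+1) lev s).+1.
have levK s : (s <= d)%N -> (lev s < K)%N.
  by move=> sd; rewrite ltnS (leq_bigmax (Ordinal (sd : s < d.+1)%N)).
pose L := budget d K.
have budgetL s j : (s <= d)%N -> (j < K)%N -> (budget s j <= L)%N.
  by move=> sd jK; rewrite /L /budget leq_mul// leq_mul// leq_exp2l// ltnW.
pose b (i : 'I_d.+1 * 'I_K * 'I_L.+1) : R :=
  expR (- ((val i.2)%:R * (mesh (val i.1.2) / (val i.1.1)%:R))).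
have [n [pt [w [w0 pt01 w1 atoms]]]] : exists (n : nat) (pt w : 'I_n -> R),
    [/\ forall j, 0 <= w j, forall j, 0 <= pt j <= 1, \sum_j w j = 1 &
        forall i, \sum_(j | pt j < b i) w j = b i].
  apply: exists_uniform_atoms => i; rewrite expR_ge0 expR_le1 oppr_le0.
  by rewrite mulr_ge0// divr_ge0// ltW// mesh_gt0.
exists n, pt.
have card_u (u : {set 'I_d}) : u != finset.set0 -> (0 < #|u| <= d)%N.
  by move=> u0; rewrite card_gt0 u0 -[leqRHS]card_ord max_card.
pose I := ({set 'I_d} * 'I_K * {ffun 'I_d -> 'I_L.+1})%type.
pose D (i : I) : R := target d N #|i.1.1|.
pose Q (i : I) := [&& i.1.1 != finset.set0, D i < 1 &
    (i.1.2 <= lev #|i.1.1|)%N] &&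
  ([forall (k | k \notin i.1.1), val (i.2 k) == 0%N] &&
   (\sum_k i.2 k <= budget #|i.1.1| i.1.2)%N).
pose f (i : I) := link pt #|i.1.1| i.1.2 (fun k => val (i.2 k)).
pose lambda (i : I) : R := D i * (12 / 5) ^+ i.1.2 / 2.
pose a (i : I) : R := N%:R * D i * (1 / 4 * (3 / 5) ^+ i.1.2).
have exact_corner (u : {set 'I_d}) : u != finset.set0 ->
    forall j k, (j <= lev #|u|)%N -> (k <= budget #|u| j)%N ->
    let c := expR (- (k%:R * (mesh j / #|u|%:R))) in
    \sum_(l | pt l < c) w l = c.
  move=> u0 j k jJ kb; have /andP[_ ud] := card_u _ u0.
  have jK : (j < K)%N by apply: leq_ltn_trans (levK _ ud).
  have kL : (k < L.+1)%N by rewrite ltnS (leq_trans kb) ?budgetL.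
  exact: (atoms (Ordinal (ud : #|u| < d.+1)%N, Ordinal jK, Ordinal kL)).
have [|||x xP] := @exists_small_deviations R _ (weight w) N I Q f a lambda
  (fun i => 4 * mesh i.1.2) (weight_ge0 w0) (weight_sum1 w1).
- move=> [[u j] m] /andP[/and3P[/= u0 D1 jJ] _].
  have [_ /(_ _ jJ) Dj] := levP _ (card_u _ u0) D1.
  rewrite /lambda /D/= ler_pM2r//; apply/andP; split => //.
  by rewrite mulr_ge0// mulr_ge0 ?ltW ?target_gt0 ?card_u.
- move=> [[u j] m] /andP[/and3P[/= u0 D1 jJ] /andP[/forallP/= mu mb]].
  have s0 : (0 < #|u|)%N by rewrite card_gt0.
  have mu' : {in [predC u], (fun k => val (m k)) =1 fun=> 0%N}.
    by move=> k ku; apply/eqP; have /implyP := mu k; exact.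
  exact: (link_variance w0 erefl s0 (exact_corner u u0) jJ mu' mb).
(* Restricting to [Q] only drops non-negative terms from the sum of [union_bound]. *)
- apply: le_lt_trans (@union_bound R d K L.+1).
  rewrite pair_big_dep /= pair_big_dep/=.
  rewrite big_mkcond [leRHS]big_mkcond/=; apply: ler_sum => -[[u j] m] _ /=.
  case: ifPn => [/andP[/and3P[/= u0 D1 jJ] /andP[h1 h2]]|_]; last first.
    by case: ifP => // _; rewrite mulr_ge0 ?expR_ge0.
  rewrite u0 h1 h2 /= ler_wpM2l// ler_expR.
  apply: exponent_le => //; first by rewrite entropy_ge1// card_u.
  by apply: target_sqr => //; exact: card_u.
exists x; split => // u u0 D1 z z01 zu.
have sd := card_u _ u0; have /andP[s0 ud] := sd.
have [Jsmall Jlambda] := levP _ sd D1.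
have D0 := target_gt0 R N0 sd.
have dev := @deviation_le R d n pt w #|u| (lev #|u|) u erefl s0
  (exact_corner u u0) N x
  (fun j => N%:R * target d N #|u| * (1 / 4 * (3 / 5) ^+ j)) z.
apply: le_trans (dev _ _ z01 zu) _.
- by move=> j; rewrite !mulr_ge0// ltW.
- move=> j m jJ mu mb; have jK : (j < K)%N by apply: leq_ltn_trans (levK _ ud).
  have mL k : (m k < L.+1)%N.
    rewrite ltnS; apply: leq_trans (budgetL _ _ ud jK).
    by apply: leq_trans mb; rewrite (bigD1 k)//= leq_addr.
  have mE : (fun k => val ([ffun k => Ordinal (mL k)] k)) = m.
    by apply/funext => k; rewrite ffunE.
  have := xP (u, Ordinal jK, [ffun k => Ordinal (mL k)]).
  rewrite /f /a /D /= mE; apply; rewrite /Q /D /= u0 D1 jJ /=.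
  apply/andP; split; last by under eq_bigr do rewrite ffunE.
  by apply/forallP => k; apply/implyP => ku; rewrite ffunE/= mu.
(* The bracketing error takes 3/8 of the target and the chain at most 5/8. *)
rewrite -mulr_sumr -mulrA -mulrDr ler_wpM2l//.
have := sum_geometric_le R (lev #|u|).+1.
by move: (\sum_(_ <= _ < _) _) => S S1; nra.
Qed.

Theorem theorem1 (R : realType) (d : nat) (gamma : {set 'I_d} -> R) (N : nat)
    (d_ge1 : (1 <= d)%N) (N_ge1 : (1 <= N)%N)
    (gamma_ge0 : forall u : {set 'I_d}, u != finset.set0 -> 0 <= gamma u) :
  exists x : 'I_N -> d.-tuple R,
    (forall n : 'I_N, unit_cube (x n)) /\
    (weighted_star_discrepancy gamma x <=
      (57 / 10 / Num.sqrt N%:R *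
        max_nonempty (fun u : {set 'I_d} =>
          gamma u
          * Num.sqrt (49 / 10 + 2 * ln (expR 1 * d%:R / #|u|%:R))
          * Num.sqrt #|u|%:R))%:E)%E.
Proof.
have [n [pt [x0 [pt01 x0P]]]] := @exists_grid_points R d N N_ge1.
pose x (k : 'I_N) : d.-tuple R := [tuple pt (x0 k i) | i < d].
have NR : 0 < N%:R :> R by rewrite ltr0n.
exists x; split=> [k i|]; first by rewrite tnth_mktuple.
have discrepancyE (z : d.-tuple R) : (forall i, 0 <= tnth z i <= 1) ->
    N%:R * discrepancy x z =
    \sum_k (in_box pt (tnth z) (x0 k))%:R - N%:R * \prod_i tnth z i.
  move=> z01; rewrite /discrepancy lebesgue_tuple_box/=; last first.
    by move=> i; have /andP[] := z01 i.
  rewrite mulrBr mulrA divff ?gt_eqF// mul1r; congr (_ - _).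
  apply: eq_bigr => k _; rewrite indicE; congr (_%:R).
  congr nat_of_bool; apply/idP/forallP => [|h].
    by rewrite inE => h i; have /andP[_] := h i; rewrite tnth_mktuple.
  by rewrite inE => i; rewrite tnth_mktuple h andbT; have /andP[] := pt01 (x0 k i).
have le_target (u : {set 'I_d}) (z : d.-tuple R) : u != finset.set0 ->
    unit_cube z -> `|discrepancy x (pad_one u z)| <= target d N #|u|.
  move=> u0 z01.
  have p01 i : 0 <= tnth (pad_one u z) i <= 1.
    rewrite tnth_mktuple; case: (i \in u); first exact: (z01 i).
    by rewrite ler01 lexx.
  rewrite -(ler_pM2l NR) -{1}(gtr0_norm NR) -normrM discrepancyE//.
  have [D1|D1] := ltP (target d N #|u| : R) 1.
    by apply: x0P => // i iu; rewrite tnth_mktuple (negbTE iu).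
  (* If the target is at least 1, it suffices that the count and [N] times the volume both lie
     between 0 and [N]. *)
  apply: (@le_trans _ _ N%:R); last by rewrite ler_peMr// ltW.
  have prod01 : 0 <= \prod_i tnth (pad_one u z) i <= 1.
    rewrite prodr_ge0/=; last by move=> i _; have /andP[] := p01 i.
    by apply: Num.Theory.prodr_ile1 => i _; exact: p01.
  have sum01 : (0 : R) <= \sum_k (in_box pt (tnth (pad_one u z)) (x0 k))%:R <= (N%:R : R).
    rewrite sumr_ge0//=; apply: (@le_trans _ _ (\sum_(k < N) 1)).
      by apply: ler_sum => k _; rewrite lern1 leq_b1.
    by rewrite sumr_const card_ord.
  by rewrite ler_norml; nra.
apply: ge_ereal_sup => _ [z z01 <-]; rewrite lee_fin.
apply: bigmax_le.
  by rewrite mulr_ge0//; exact: bigmax_ge_id.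
move=> u u0; apply: le_trans (ler_wpM2l (gamma_ge0 u u0) (le_target u z u0 z01)) _.
rewrite /target mulrCA ler_wpM2l//.
rewrite mulrA; exact: (le_bigmax_cond 0 (fun u : {set 'I_d} => gamma u *
  Num.sqrt (49 / 10 + 2 * entropy d #|u|) * Num.sqrt #|u|%:R) u0).
Qed.
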